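(* Let $d_n^B(x;1/2)$ be defined by $\sum_{n\ge0}d_n^B(x;1/2)\frac{z^n}{n!}=\left(\frac{(1-x)e^{z/2}}{e^{xz}-xe^{z}}\right)^{2}$. For $n\geq1$, $$d_n^B(x;1/2)=\frac{1}{x}d_{n+1}(x)+d_n(x),$$ and $$d_n^B(x;1/2)=\sum_{\pi\in\mathfrak{S}_{n+1}^s}x^{\mathrm{asc}(\pi)}.$$
   Context: $d_n(x)=\sum_{\pi}x^{\mathrm{exc}(\pi)}$ is the classical derangement polynomial, the sum over permutations $\pi\in\mathfrak{S}_n$ with no fixed points, where $\mathrm{exc}(\pi)=\#\{i:\pi(i)>i\}$ (with $d_0(x)=1$). For $\pi\in\mathfrak{S}_n$, an ascent is $i\in[n-1]$ with $\pi(i)<\pi(i+1)$, $\mathrm{asc}(\pi)$ is the number of ascents, and a succession is $i\in[n-1]$ with $\pi(i+1)=\pi(i)+1$; $\mathfrak{S}_n^s$ is the set of permutations in $\mathfrak{S}_n$ with no successions. *)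

(* Defs.v *)
From HB Require Import structures.
From mathcomp Require Import all_boot all_order all_algebra all_fingroup.
Set Implicit Arguments. Unset Strict Implicit. Unset Printing Implicit Defensive.
Import Order.TTheory GRing.Theory Num.Theory.
Local Open Scope ring_scope.

Notation Rx := {poly rat}.

Definition fps := nat -> Rx.

Definition fmul (f g : fps) : fps :=
  fun n => \sum_(i < n.+1) f i * g (n - i)%N.

Definition expS (c : Rx) : fps :=
  fun n => ((n`!)%:R ^-1 : rat) *: c ^+ n.

Definition egf (a : nat -> Rx) : fps :=
  fun n => ((n`!)%:R ^-1 : rat) *: a n.

Definition denS : fps := fun n => expS 'X n - 'X * expS 1 n.

Definition numS : fps := fun n => (1 - 'X) * expS ((2%:R ^-1 : rat)%:P) n.

(* a is the coefficient sequence of d_n^B(x;1/2):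
   sum_n a_n z^n/n! = ((1-x)e^{z/2} / (e^{xz} - x e^z))^2, stated as the
   formal power series identity  EGF(a) * den^2 = num^2  (den has invertible-in-Q(x),
   nonzero constant term 1-x, so this determines a uniquely). *)
Definition is_dB (a : nat -> Rx) : Prop :=
  forall n, fmul (egf a) (fmul denS denS) n = fmul numS numS n.

Definition derpoly (n : nat) : Rx :=
  \sum_(s : 'S_n | [forall i : 'I_n, s i != i]) 'X ^+ #|[set i : 'I_n | (i < s i)%N]|.

Definition asc (m : nat) (s : 'S_m.+1) : nat :=
  #|[set i : 'I_m.+1 | (i < m)%N && (s i < s (inord i.+1))%N]|.

Definition no_succ (m : nat) (s : 'S_m.+1) : bool :=
  [forall i : 'I_m.+1, (i < m)%N ==> (val (s (inord i.+1)) != (s i).+1)].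

(* Main.v *)
Require Import Defs.
From HB Require Import structures.
From mathcomp Require Import all_boot all_order all_algebra all_fingroup.
From mathcomp Require Import ring zify.
Import GRing.Theory Num.Theory.
Local Open Scope ring_scope.
Set Implicit Arguments. Unset Strict Implicit. Unset Printing Implicit Defensive.

(** Let [d n] be the derangement polynomials and [q n] the ascent polynomials of
    the permutations of [n+1] letters without successions. Inserting the largest
    letter into a cycle, resp. into the one-line word, gives
      [d (n+2) = (n+1) x (d (n+1) + d n) + x (1-x) d (n+1)'],
      [q (n+2) = q (n+1) + (n+1) x (q (n+1) + q n) + x (1-x) q (n+1)'],
    where the terms [d n], [q n] come from inserting at the only fixed point,
    resp. inside the only succession. By induction [x q n = d (n+1) + x d n].
    With [D] the exponential generating function of [d] and
    [E = e^(xz) - x e^z], the first recurrence is a linear PDE for [D], which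
    makes [P = D E] satisfy [P_z = x z P_z + x (1-x) P_x + x P]; hence [P = 1-x].
    Finally [(D_z + x D) E^2 = (1-x) (x E - E_z) = x (1-x)^2 e^z]. *)

(** * Formal power series *)

Definition fderiv (f : fps) : fps := fun n => f n.+1 *+ n.+1.

(** Polynomials in z over Q[x]: identities for [fmul] at index [n] are read off from truncations
    beyond [n]. *)
Definition trunc (N : nat) (f : fps) : {poly {poly rat}} := \poly_(i < N) f i.

Lemma coef_trunc N f n : (n < N)%N -> (trunc N f)`_n = f n.
Proof. by move=> h; rewrite coef_poly h. Qed.

Lemma coef_truncM N f g n : (n < N)%N ->
  (trunc N f * trunc N g)`_n = fmul f g n.
Proof.
move=> nN; rewrite coefM; apply: eq_bigr => i _.
rewrite !coef_trunc //; first by rewrite (leq_ltn_trans (leq_subr _ _)).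
by rewrite (leq_trans (ltn_ord i)).
Qed.

Lemma eq_fmul f f' g g' : f =1 f' -> g =1 g' -> fmul f g =1 fmul f' g'.
Proof. by move=> ff gg n; apply: eq_bigr => i _; rewrite ff gg. Qed.

Lemma fmulC f g : fmul f g =1 fmul g f.
Proof. by move=> n; rewrite -!(@coef_truncM n.+1) // mulrC. Qed.

Lemma coefM_prefix (R : nzRingType) (p p' q q' : {poly R}) n :
  (forall i, (i <= n)%N -> p`_i = p'`_i) ->
  (forall i, (i <= n)%N -> q`_i = q'`_i) -> (p * q)`_n = (p' * q')`_n.
Proof.
move=> hp hq; rewrite !coefM; apply: eq_bigr => i _.
by rewrite hp ?hq ?leq_subr // -ltnS.
Qed.

Lemma fmulA f g h : fmul f (fmul g h) =1 fmul (fmul f g) h.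
Proof.
move=> n; rewrite -!(@coef_truncM n.+1) //.
transitivity ((trunc n.+1 f * (trunc n.+1 g * trunc n.+1 h))`_n).
  by apply: coefM_prefix => // i hi; rewrite coef_truncM // coef_trunc.
rewrite mulrA.
by apply: coefM_prefix => // i hi; rewrite coef_truncM // coef_trunc.
Qed.

Lemma fmulDl f f' g n :
  fmul (fun i => f i + f' i) g n = fmul f g n + fmul f' g n.
Proof. by rewrite -big_split /=; apply: eq_bigr => i _; rewrite mulrDl. Qed.

Lemma fmulZl c f g n : fmul (fun i => c * f i) g n = c * fmul f g n.
Proof. by rewrite /fmul mulr_sumr; apply: eq_bigr => i _; rewrite mulrA. Qed.

Lemma fmulZr c f g n : fmul f (fun i => c * g i) n = c * fmul f g n.
Proof. by rewrite fmulC fmulZl fmulC. Qed.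

Lemma fmulDr f g g' n :
  fmul f (fun i => g i + g' i) n = fmul f g n + fmul f g' n.
Proof. by rewrite fmulC fmulDl !(fmulC f). Qed.

(** Truncation at [n.+2] keeps the coefficient [n.+1], which derivation moves to index [n]. *)
Lemma fderivM f g n :
  fderiv (fmul f g) n = fmul (fderiv f) g n + fmul f (fderiv g) n.
Proof.
rewrite /fderiv -(@coef_truncM n.+2) // -coef_deriv derivM coefD.
by congr (_ + _); rewrite -(@coef_truncM n.+1) //; apply: coefM_prefix => i hi;
  rewrite ?coef_deriv !coef_trunc //; lia.
Qed.

(** Multiplication by z. *)
Definition fshift (f : fps) : fps := fun n => if n is k.+1 then f k else 0.

Lemma fmul_shiftl f g n : fmul (fshift f) g n = fshift (fmul f g) n.
Proof.
case: n => [|n]; first by rewrite /fmul big_ord1 mul0r.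
by rewrite /fmul big_ord_recl mul0r add0r; apply: eq_bigr.
Qed.

Lemma fmul_shiftr f g n : fmul f (fshift g) n = fshift (fmul f g) n.
Proof. by rewrite fmulC fmul_shiftl; case: n => //= n; rewrite fmulC. Qed.

Definition fderivx (f : fps) : fps := fun n => (f n)^`().

Lemma fderivxM f g n :
  fderivx (fmul f g) n = fmul (fderivx f) g n + fmul f (fderivx g) n.
Proof.
rewrite /fderivx /fmul raddf_sum /= -big_split /=.
by apply: eq_bigr => i _; rewrite derivM.
Qed.

(** The Euler operator z d/dz. *)
Definition ftheta (f : fps) : fps := fun n => f n *+ n.

Lemma fthetaM f g n :
  ftheta (fmul f g) n = fmul (ftheta f) g n + fmul f (ftheta g) n.
Proof.
rewrite /ftheta /fmul -sumrMnl -big_split /=; apply: eq_bigr => i _.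
by rewrite mulrnAl mulrnAr -mulrnDr subnKC // -ltnS.
Qed.

Lemma fderiv_egf a : fderiv (egf a) =1 egf (fun n => a n.+1).
Proof.
move=> n; rewrite /fderiv /egf factS natrM -scaler_nat scalerA; congr (_ *: _).
by rewrite invfM mulrA divff ?mul1r // pnatr_eq0.
Qed.

Lemma fderiv_exp c n : fderiv (expS c) n = c * expS c n.
Proof.
rewrite (fderiv_egf (fun n => c ^+ n)) /egf /expS exprS.
by rewrite -scalerAr.
Qed.

(** Both sides solve f_z = (a+b) f with constant term 1, which fixes the coefficients successively
    as [n.+1] is invertible in [rat]. *)
Lemma fmul_exp a b : fmul (expS a) (expS b) =1 expS (a + b).
Proof.
elim=> [|n IH]; first by rewrite /fmul big_ord1 /expS !expr0
  -scalerAr mulr1 scalerA invr1 mulr1.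
have nz : n.+1%:R != 0 :> rat by rewrite pnatr_eq0.
apply: (scalerI nz); rewrite !scaler_nat -!/(fderiv _ n) fderivM fderiv_exp.
rewrite (eq_fmul (fderiv_exp a) (frefl _)) (eq_fmul (frefl _) (fderiv_exp b)).
by rewrite fmulZl fmulZr IH mulrDl.
Qed.

(** * The series [numS] and [denS], and uniqueness of the sequence they define *)

Lemma numS_square n : fmul numS numS n = (1 - 'X) ^+ 2 * expS 1 n.
Proof.
rewrite /numS fmulZl fmulZr fmul_exp mulrA -expr2; congr (_ * expS _ _).
by rewrite -polyCD -polyC1; congr _%:P.
Qed.

Lemma denS0 : denS 0 = 1 - 'X.
Proof. by rewrite /denS /expS !expr0 invr1 !scale1r mulr1. Qed.

Lemma subr1X_neq0 : 1 - 'X != 0 :> {poly rat}.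
Proof.
apply/eqP => /(congr1 (fun p : {poly rat} => p`_1)).
by rewrite coefB coef1 coefX coef0.
Qed.

(** By induction the sums at index [n] differ at most in the term with [h 0], which cancels because
    Q[x] is a domain. *)
Lemma fmul_inj f g h : h 0%N != 0 -> fmul f h =1 fmul g h -> f =1 g.
Proof.
move=> h0 E; elim/ltn_ind => n IH.
have := E n; rewrite /fmul !big_ord_recr /= subnn.
rewrite (eq_bigr (fun i : 'I_n => g i * h (n - i)%N)); last first.
  by move=> i _; rewrite IH.
by move/addrI; apply: mulIf.
Qed.

Lemma egf_inj a b : egf a =1 egf b -> a =1 b.
Proof.
move=> E n; have := E n; apply: scalerI.
by rewrite invr_eq0 pnatr_eq0 -lt0n fact_gt0.
Qed.

Lemma is_dB_unique a b : is_dB a -> is_dB b -> a =1 b.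
Proof.
move=> ha hb; apply/egf_inj/(@fmul_inj _ _ (fmul denS denS)).
  by rewrite /fmul big_ord1 denS0 mulf_neq0 ?subr1X_neq0.
by move=> n; rewrite ha hb.
Qed.

Lemma fderiv_den n :
  fderiv denS n = 'X * expS 'X n - 'X * expS 1 n.
Proof.
have E : fderiv denS n = fderiv (expS 'X) n - 'X * fderiv (expS 1) n.
  by rewrite /fderiv /denS mulrnBl mulrnAr.
by rewrite E !fderiv_exp mul1r.
Qed.

Lemma fderivx_expX : fderivx (expS 'X) =1 fshift (expS 'X).
Proof.
case=> [|n]; rewrite /fderivx /expS derivZ derivXn ?mulr0n ?scaler0 //=.
rewrite factS natrM -scaler_nat scalerA; congr (_ *: _).
by rewrite invfM mulrAC mulVf ?mul1r // pnatr_eq0.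
Qed.

Lemma fderivx_exp1 n : fderivx (expS 1) n = 0.
Proof. by rewrite /fderivx /expS expr1n derivZ derivC scaler0. Qed.

Lemma ftheta_exp c n : ftheta (expS c) n = c * fshift (expS c) n.
Proof. by case: n => [|n]; rewrite /ftheta /= ?mulr0 // -fderiv_exp. Qed.

(** For E = [denS]: E_z = x E - x z E + x z E_z + x (1-x) E_x. All terms are combinations of e^(xz),
    e^z and their multiples by z. *)
Lemma den_pde n :
  fderiv denS n = 'X * denS n + - 'X * fshift denS n + 'X * ftheta denS n
    + 'X * (1 - 'X) * fderivx denS n.
Proof.
rewrite fderiv_den.
have -> : fderivx denS n = fshift (expS 'X) n - expS 1 n.
  rewrite -fderivx_expX /fderivx /denS derivB derivM derivX mul1r.
  by rewrite -[(expS 1 n)^`()]/(fderivx (expS 1) n) fderivx_exp1 mulr0 addr0.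
have -> : ftheta denS n = 'X * fshift (expS 'X) n - 'X * fshift (expS 1) n.
  have -> : ftheta denS n = ftheta (expS 'X) n - 'X * ftheta (expS 1) n.
    by rewrite /ftheta /denS mulrnBl mulrnAr.
  by rewrite !ftheta_exp mul1r.
have -> : fshift denS n = fshift (expS 'X) n - 'X * fshift (expS 1) n.
  by case: n => [|n] //=; rewrite mulr0 subr0.
rewrite /denS; ring.
Qed.

(* The two shift terms cancel in the product. *)
Lemma fmul_pde f g :
  (forall n, fderiv f n = 'X * ftheta f n + 'X * fshift f n
    + 'X * (1 - 'X) * fderivx f n) ->
  (forall n, fderiv g n = 'X * g n + - 'X * fshift g n + 'X * ftheta g n
    + 'X * (1 - 'X) * fderivx g n) ->
  forall n, fmul f g n.+1 *+ n.+1 = 'X * fmul f g n *+ n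
    + 'X * (1 - 'X) * (fmul f g n)^`() + 'X * fmul f g n.
Proof.
move=> hf hg n; rewrite -[LHS]/(fderiv (fmul f g) n) fderivM.
rewrite (eq_fmul hf (frefl _)) (eq_fmul (frefl _) hg).
rewrite !fmulDr !fmulZr !fmulDl !fmulZl fmul_shiftl fmul_shiftr.
rewrite -mulrnAr -[fmul f g n *+ n]/(ftheta (fmul f g) n) fthetaM.
rewrite -[(fmul f g n)^`()]/(fderivx (fmul f g) n) fderivxM.
by ring.
Qed.

(** * The generating function of the derangement polynomials *)

Section DerangementSeries.

Variable d : nat -> {poly rat}.
Hypotheses (d0 : d 0 = 1) (d1 : d 1 = 0).
Hypothesis drec : forall n, d n.+2 =
  'X * (d n.+1 + d n) *+ n.+1 + 'X * (1 - 'X) * (d n.+1)^`().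

Let D := egf d.

(** This is [drec] divided by (n+1)!; index 0 is settled by [d0] and [d1]. *)
Lemma egf_pde n :
  fderiv D n = 'X * ftheta D n + 'X * fshift D n
    + 'X * (1 - 'X) * fderivx D n.
Proof.
rewrite fderiv_egf /ftheta /fderivx /D; case: n => [|n].
  by rewrite /egf /= d0 d1 derivZ derivC mulr0n !scaler0 !mulr0 !addr0.
rewrite [fshift _ _]/=.
have -> : egf d n = ((n.+1)`!%:R^-1 : rat) *: (d n *+ n.+1).
  rewrite /egf -scaler_nat scalerA factS natrM invfM mulrAC mulVf ?mul1r //.
  by rewrite pnatr_eq0.
rewrite /egf drec derivZ scalerMnr -!scalerAr -!scalerDr; congr (_ *: _).
by ring.
Qed.

(** The product equation yields coefficient [n.+1] from coefficient [n], so zeros propagate once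
    coefficient 1 vanishes. *)
Lemma fmul_egf_den n : fmul D denS n = (1 - 'X) *+ (n == 0)%N.
Proof.
have P0 : fmul D denS 0 = 1 - 'X.
  by rewrite /fmul big_ord1 denS0 /D /egf d0 invr1 scale1r mul1r.
have rec k : fmul D denS k.+1 *+ k.+1 = 'X * fmul D denS k *+ k
    + 'X * (1 - 'X) * (fmul D denS k)^`() + 'X * fmul D denS k.
  exact: (fmul_pde egf_pde den_pde).
case: n => [|n]; first exact: P0.
have nz k : k.+1%:R != 0 :> rat by rewrite pnatr_eq0.
elim: n => [|n IH].
  (* Coefficient 1: x (1-x) (1-x)' = - x (1-x) cancels x (1-x). *)
  apply: (scalerI (nz 0%N)); rewrite [LHS]scaler_nat rec P0 derivB derivX derivC.
  by rewrite /= !mulr0n scaler0; ring.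
apply: (scalerI (nz n.+1)); rewrite [LHS]scaler_nat rec IH /=.
by rewrite !mulr0n derivC !mulr0 mul0rn !addr0 scaler0.
Qed.

(** With A = [egf a] the hypothesis reads x A = D_z + x D, so the identity is proved times x. As D E
    is constant in z, D_z E = - D E_z. *)
Lemma is_dB_of_derangement a :
  (forall n, 'X * a n = d n.+1 + 'X * d n) -> is_dB a.
Proof.
move=> ha n; rewrite numS_square.
have E : (fun i => 'X * egf a i) =1 (fun i => fderiv D i + 'X * D i).
  move=> i; rewrite fderiv_egf /egf -scalerAr ha scalerDr.
  by rewrite /D /egf scalerAr.
apply: (mulfI (negbT (polyX_eq0 rat))).
rewrite -fmulZl (eq_fmul E (frefl _)) fmulDl fmulZl !fmulA.
have Dd : fmul (fderiv D) denS =1 fun k => -1 * fmul D (fderiv denS) k.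
  move=> k; have := fderivM D denS k.
  rewrite /fderiv fmul_egf_den mul0rn mulN1r => /eqP.
  by rewrite eq_sym addr_eq0 => /eqP.
have c1 f k : fmul (fmul D denS) f k = (1 - 'X) * f k.
  rewrite (eq_fmul fmul_egf_den (frefl _)) /fmul big_ord_recl subn0.
  by rewrite big1 ?addr0 // => i _; rewrite mul0r.
rewrite (eq_fmul Dd (frefl _)) fmulZl -fmulA.
rewrite (eq_fmul (frefl _) (fmulC _ _)) fmulA !c1 fderiv_den /denS.
ring.
Qed.

End DerangementSeries.

(** * Permutations with a prescribed value *)

Lemma lift_perm_inj n (i j : 'I_n.+1) : injective (lift_perm i j).
Proof.
move=> s t E; apply/permP => k; apply: (@lift_inj _ j).
by rewrite -(lift_perm_lift i) E lift_perm_lift.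
Qed.

(** By injectivity [s] maps the complement of [i] into that of [j]; relabelling both gives [t]. *)
Lemma lift_perm_onto n (i j : 'I_n.+1) (s : 'S_n.+1) :
  s i = j -> exists t, s = lift_perm i j t.
Proof.
move=> sij.
have P k : {l | s (lift i k) = lift j l}.
  case: (unliftP j (s (lift i k))) => [l ->|E]; first by exists l.
  have := neq_lift i k; rewrite -(inj_eq (@perm_inj _ s)) sij E.
  by rewrite eqxx.
have tinj : injective (fun k => sval (P k)).
  move=> k l /= E; apply: (@lift_inj _ i); apply: (@perm_inj _ s).
  by move: E; case: (P k) => ? /= ->; case: (P l) => ? /= -> ->.
exists (perm tinj); apply/permP => k.
case: (unliftP i k) => [l ->|->]; last by rewrite lift_perm_id.
by rewrite lift_perm_lift permE; case: (P l).
Qed.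

Lemma sum_lift_perm (V : nmodType) n (i j : 'I_n.+1) (F : 'S_n.+1 -> V) :
  \sum_(s : 'S_n.+1 | s i == j) F s = \sum_t F (lift_perm i j t).
Proof.
rewrite -(big_imset _ (in2W (@lift_perm_inj n i j))) /=.
apply: eq_bigl => s; apply/eqP/imsetP => [/lift_perm_onto[t ->]|[t _ ->]].
  by exists t.
by rewrite lift_perm_id.
Qed.

Lemma sum_perm_lift_max (V : nmodType) n (F : 'S_n.+1 -> V) :
  \sum_s F s = \sum_(s : 'S_n) \sum_(i : 'I_n.+1) F (lift_perm i ord_max s).
Proof.
rewrite exchange_big /=.
rewrite (partition_big (fun s : 'S_n.+1 => s^-1%g ord_max) xpredT) //=.
apply: eq_bigr => i _; rewrite -sum_lift_perm; apply: eq_bigl => s.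
by rewrite (canF_eq (permKV s)) eq_sym.
Qed.

(** The left factor acts first: [i] goes to the new letter, and the new letter to the old image of
    [i]. For [i = ord_max] the new letter is a fixed point. *)
Lemma sum_perm_insert_cycle (V : nmodType) n (F : 'S_n.+1 -> V) :
  \sum_s F s = \sum_(s : 'S_n) \sum_(i : 'I_n.+1)
    F (tperm i ord_max * lift_perm ord_max ord_max s)%g.
Proof.
rewrite exchange_big /=.
rewrite (partition_big (fun s : 'S_n.+1 => s^-1%g ord_max) xpredT) //=.
apply: eq_bigr => i _.
rewrite -(sum_lift_perm _ _ (fun s => F (tperm i ord_max * s)%g)).
(* Multiplying by the transposition exchanges the permutations sending [i] to [ord_max] with those
   fixing [ord_max]. *)
rewrite (reindex_inj (mulgI (tperm i ord_max))); apply: eq_bigl => s /=.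
by rewrite (canF_eq (permKV _)) permM tpermL eq_sym.
Qed.

Lemma forall_lift n (j : 'I_n.+1) (P : pred 'I_n.+1) :
  [forall i, P i] = P j && [forall k, P (lift j k)].
Proof.
apply/forallP/andP => [h|[Pj /forallP h] i]; first by split; last apply/forallP.
by case: (unliftP j i) => [k ->|->].
Qed.

Lemma ltn_bump2 h k l : (bump h k < bump h l)%N = (k < l)%N.
Proof. by rewrite !ltnNge leq_bump2. Qed.

(** * Derangements *)

Definition exc n (s : 'S_n) : nat := \sum_(i < n) (i < s i)%N.

Definition der n (s : 'S_n) : bool := [forall i, s i != i].

Lemma card_set_sum n (P : pred 'I_n) : #|[set i | P i]| = (\sum_(i < n) P i)%N.
Proof.
rewrite cardsE -sum1_card big_mkcond; apply: eq_bigr => i _.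
by rewrite unfold_in; case: (P i).
Qed.

Lemma derpolyE n : derpoly n = \sum_(s : 'S_n | der s) 'X ^+ exc s.
Proof. by apply: eq_bigr => s _; rewrite card_set_sum. Qed.

Section InsertCycle.
Variables (n : nat) (s : 'S_n.+1) (k : 'I_n.+1).

Let t := (tperm (lift ord_max k) ord_max * lift_perm ord_max ord_max s)%g.

Lemma insert_cycle_max : t ord_max = lift ord_max (s k).
Proof. by rewrite permM tpermR lift_perm_lift. Qed.

Lemma insert_cycle_at : t (lift ord_max k) = ord_max.
Proof. by rewrite permM tpermL lift_perm_id. Qed.

Lemma insert_cycle_other l : l != k -> t (lift ord_max l) = lift ord_max (s l).
Proof.
move=> lk; rewrite permM tpermD ?lift_perm_lift //; last by rewrite neq_lift.
by rewrite (inj_eq (@lift_inj _ _)) eq_sym.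
Qed.

(** The new letter is no excedance, [k] becomes one, and all other positions keep their status. *)
Lemma exc_insert_cycle : (exc t + (k < s k) = (exc s).+1)%N.
Proof.
rewrite /exc (bigD1_ord ord_max) //= insert_cycle_max /=.
rewrite (bigD1 k) //= insert_cycle_at [in RHS](bigD1 k) //=.
rewrite (eq_bigr (fun l : 'I_n.+1 => nat_of_bool (l < s l)%N)); last first.
  by move=> l lk; rewrite insert_cycle_other //= ltn_bump2.
have := ltn_ord k; have := ltn_ord (s k); rewrite /bump /=.
by move: (nat_of_ord k) (nat_of_ord (s k)) (\sum_(i < _ | _) _)%N; lia.
Qed.

(** Insertion after [k] destroys a fixed point at [k] and no other. *)
Lemma der_insert_cycle : der t = [forall l, (l != k) ==> (s l != l)].
Proof.
rewrite /der (forall_lift ord_max (fun i => t i != i)) insert_cycle_max.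
rewrite eq_sym neq_lift /=.
apply: eq_forallb => l; case: (eqVneq l k) => [->|lk] /=.
  by rewrite insert_cycle_at neq_lift.
by rewrite insert_cycle_other // (inj_eq (@lift_inj _ _)).
Qed.

End InsertCycle.

Lemma der_insert_fix n (s : 'S_n.+1) :
  der (tperm ord_max ord_max * lift_perm ord_max ord_max s)%g = false.
Proof.
by apply/negbTE/forallPn; exists ord_max; rewrite permM tpermL lift_perm_id eqxx.
Qed.

Lemma exc_lift_fix n (k : 'I_n.+1) (s : 'S_n) : exc (lift_perm k k s) = exc s.
Proof.
rewrite /exc (bigD1_ord k) //= lift_perm_id ltnn add0n.
by apply: eq_bigr => l _; rewrite lift_perm_lift /= ltn_bump2.
Qed.

Lemma der_but_lift_fix n (k : 'I_n.+1) (s : 'S_n) :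
  [forall l, (l != k) ==> (lift_perm k k s l != l)] = der s.
Proof.
rewrite (forall_lift k (fun l => (l != k) ==> (lift_perm k k s l != l))) eqxx /=.
apply: eq_forallb => l.
by rewrite eq_sym neq_lift lift_perm_lift (inj_eq (@lift_inj _ _)).
Qed.

(* Origin of the operator ['X n + 'X (1 - 'X) d/dx]: of [n] insertion slots, those
   at the [a] excedances (ascents) keep the exponent, the others raise it. *)
Lemma sum_exponent_shift n (e : 'I_n -> nat) (a : nat) (b : 'I_n -> bool) :
  (\sum_i b i = a)%N -> (forall i, e i + b i = a.+1)%N ->
  \sum_i 'X ^+ e i = 'X * 'X ^+ a *+ n
     + 'X * (1 - 'X) * ('X ^+ a)^`() :> {poly rat}.
Proof.
move=> ab eb.
have Xd : 'X * ('X ^+ a)^`() = 'X ^+ a *+ a :> {poly rat}.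
  by rewrite derivXn mulrnAr; case: (a) => [|c]; rewrite ?mulr0n // -exprS.
rewrite -mulrA [(1 - 'X) * _]mulrC mulrA Xd.
transitivity (\sum_(i < n) ('X ^+ a.+1 + ('X ^+ a - 'X ^+ a.+1) *+ b i) : {poly rat}).
  apply: eq_bigr => i _; have := eb i; case: (b i) => /=.
    by rewrite addn1 => -[->]; rewrite mulr1n addrC subrK.
  by rewrite addn0 mulr0n addr0 => ->.
rewrite big_split /= sumr_const card_ord sumrMnr ab -exprS.
by congr (_ + _); rewrite mulrnAl mulrBr mulr1 -exprSr.
Qed.

Lemma derpoly_rec n : derpoly n.+2 =
  'X * (derpoly n.+1 + derpoly n) *+ n.+1 + 'X * (1 - 'X) * (derpoly n.+1)^`().
Proof.
rewrite !derpolyE [LHS]big_mkcond sum_perm_insert_cycle /=.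
under eq_bigr => s _.
  rewrite (bigD1_ord ord_max) //= der_insert_fix add0r -big_mkcond /=.
  under eq_bigl => k do rewrite der_insert_cycle.
  rewrite (bigID (fun k => s k == k)) /=.
  over.
rewrite big_split /=.
(* Here [k] is the only fixed point of [s]; deleting it leaves a derangement of [n] letters, and the
   insertion adds one excedance. *)
have -> : \sum_(s : 'S_n.+1)
    \sum_(k | [forall l, (l != k) ==> (s l != l)] && (s k == k))
       'X ^+ exc (tperm (lift ord_max k) ord_max * lift_perm ord_max ord_max s)
  = 'X * (\sum_(s : 'S_n | der s) 'X ^+ exc s) *+ n.+1 :> {poly rat}.
  rewrite (exchange_big_dep xpredT) //=.
  rewrite -[X in _ *+ X]card_ord -sumr_const; apply: eq_bigr => k _.
  rewrite (eq_bigl (fun s : 'S_n.+1 => (s k == k) &&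
    [forall l, (l != k) ==> (s l != l)])); last first.
    by move=> s; rewrite andbC.
  rewrite big_mkcondr sum_lift_perm -big_mkcond /= mulr_sumr.
  apply: eq_big => s; first exact: der_but_lift_fix.
  move=> _; rewrite -exprS; congr (_ ^+ _).
  have := exc_insert_cycle (lift_perm k k s) k.
  by rewrite exc_lift_fix lift_perm_id ltnn addn0.
(* Here [s] is itself a derangement and every [k] is admissible. *)
have -> : \sum_(s : 'S_n.+1)
    \sum_(k | [forall l, (l != k) ==> (s l != l)] && (s k != k))
       'X ^+ exc (tperm (lift ord_max k) ord_max * lift_perm ord_max ord_max s)
  = \sum_(s : 'S_n.+1 | der s) ('X * 'X ^+ exc s *+ n.+1
     + 'X * (1 - 'X) * ('X ^+ exc s)^`()) :> {poly rat}.
  rewrite [RHS]big_mkcond; apply: eq_bigr => s _.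
  case: ifP => ds; last first.
    apply: big_pred0 => k; apply/negbTE; apply: contraFN ds.
    case/andP=> /forallP h sk; apply/forallP => l.
    by have := h l; case: eqVneq => [->|].
  rewrite -(sum_exponent_shift (b := fun k : 'I_n.+1 => (k < s k)%N)
    (erefl _) (exc_insert_cycle s)).
  apply: eq_bigl => k; rewrite (forallP ds) andbT.
  by apply/forallP => l; rewrite (forallP ds) implybT.
rewrite big_split /= sumrMnl -!mulr_sumr -raddf_sum /=.
by ring.
Qed.

Lemma derpoly0 : derpoly 0 = 1.
Proof.
rewrite derpolyE (big_pred1 (1%g : 'S_0)) => [|s].
  by rewrite /exc big_ord0.
have -> : s = 1%g by apply/permP => -[].
by rewrite /= eqxx; apply/forallP => -[].
Qed.

Lemma derpoly1 : derpoly 1 = 0.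
Proof.
rewrite derpolyE big_pred0 // => s.
by apply/negbTE/forallPn; exists ord0; rewrite [s _]ord1 eqxx.
Qed.

(** * Words without successions *)

(** Positions in [nat] avoid casts for [k.+1]; beyond [m] the value is the default [s ord0], hence
    the bounds tested below. *)
Definition word m (s : 'S_m.+1) (k : nat) : nat := s (inord k).

Definition nsucc m (s : 'S_m.+1) : nat :=
  \sum_(0 <= k < m) (word s k.+1 == (word s k).+1).

Lemma word_le m (s : 'S_m.+1) k : (word s k <= m)%N.
Proof. by rewrite -ltnS ltn_ord. Qed.

Lemma ascE m (s : 'S_m.+1) :
  asc s = (\sum_(0 <= k < m) (word s k < word s k.+1))%N.
Proof.
rewrite big_mkord /asc card_set_sum big_ord_recr /= ltnn addn0.
by apply: eq_bigr => i _; rewrite /word ltn_ord -[widen_ord _ i]inord_val.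
Qed.

Lemma no_succE m (s : 'S_m.+1) : no_succ s = (nsucc s == 0%N).
Proof.
rewrite /nsucc big_mkord sum_nat_eq0; apply/forallP/forallP => /= h i.
  have ii : @inord m i = i :> nat by rewrite inordK // ltnW // ltnS ltn_ord.
  by have := h (inord i); rewrite ii ltn_ord eqb0.
apply/implyP => im; have := h (Ordinal im).
by rewrite eqb0 /= /word inord_val.
Qed.

(** Inserting [v] at position [i] replaces one adjacent pair by two, or adds a single pair at an
    end. The lost pair stands on the left to avoid subtraction. *)
Lemma sum_insert (h : nat -> nat -> nat) (f g : nat -> nat) (v m i : nat) :
  (i <= m.+1)%N ->
  (forall k, (k <= m.+1)%N ->
     g k = if (k < i)%N then f k else if k == i then v else f k.-1) ->
  (\sum_(0 <= k < m.+1) h (g k) (g k.+1)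
     + (0 < i <= m) * h (f i.-1) (f i) =
   \sum_(0 <= k < m) h (f k) (f k.+1)
     + (0 < i) * h (f i.-1) v + (i <= m) * h v (f i))%N.
Proof.
elim: m => [|m IH] im gE.
  rewrite big_nat1 big_nil; case: i im gE => [|[|//]] _ gE.
    by rewrite !gE //= mul0n mul1n addn0.
  by rewrite !gE //= !mul0n mul1n !addn0.
move: im; rewrite leq_eqVlt => /predU1P[ei|im].
  rewrite ei ltnn /= mul0n !addn0 mul1n big_nat_recr //=.
  congr addn; last by rewrite !gE // ei ltnn eqxx ltnSn.
  apply: eq_big_nat => k /andP[_ km]; rewrite !gE ?ei; [|lia..].
  by rewrite ltnS (ltnW km) ltnS km.
rewrite big_nat_recr // [in RHS]big_nat_recr //=.
have {}IH := IH im (fun k hk => gE k (leqW hk)).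
have g2 : g m.+2 = f m.+1 by rewrite gE // ifN ?ifN //; lia.
(* For [i = m.+1] the last old pair is the one split; otherwise it survives. *)
have {im}[ei|im] : i = m.+1 \/ (i <= m)%N by lia.
  have g1 : g m.+1 = v by rewrite gE // ei ltnn eqxx.
  move: IH; rewrite g1 g2 ei ltnn leqnn /=.
  move: (\sum_(0 <= k < m.+1) _)%N (\sum_(0 <= k < m) _)%N => a b.
  move: (h _ _) (h _ _) (h _ _) => x y z; lia.
have g1 : g m.+1 = f m by rewrite gE // ifN ?ifN //; lia.
move: IH; rewrite g1 g2 im (leqW im) !andbT.
move: (\sum_(0 <= k < m.+1) _)%N (\sum_(0 <= k < m) _)%N => a b.
move: (_ * h _ _)%N => x; move: (_ * h _ _)%N => y; move: (h v _) => z; lia.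
Qed.

Section WordLift.
Variables (m : nat) (s : 'S_m.+1) (i j : 'I_m.+2).

Lemma word_lift k : (k <= m.+1)%N -> word (lift_perm i j s) k =
  if (k < i)%N then bump j (word s k)
  else if k == i then val j else bump j (word s k.-1).
Proof.
move=> km; rewrite /word; case: (ltngtP k i) => ki.
- have -> : inord k = lift i (inord k : 'I_m.+1).
    have := ltn_ord i => im.
    by apply: val_inj; rewrite /= /bump !inordK //; lia.
  by rewrite lift_perm_lift.
- have -> : inord k = lift i (inord k.-1 : 'I_m.+1).
    by apply: val_inj; rewrite /= /bump !inordK //; lia.
  by rewrite lift_perm_lift.
- by rewrite ki inord_val lift_perm_id.
Qed.

Lemma sum_word_lift (h : nat -> nat -> bool) :
  (\sum_(0 <= k < m.+1)
       h (word (lift_perm i j s) k) (word (lift_perm i j s) k.+1)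
     + [&& 0 < i, i <= m & h (bump j (word s i.-1)) (bump j (word s i))] =
   \sum_(0 <= k < m) h (bump j (word s k)) (bump j (word s k.+1))
     + ((0 < i) && h (bump j (word s i.-1)) j)
     + ((i <= m) && h j (bump j (word s i))))%N.
Proof.
have im : (i <= m.+1)%N by rewrite -ltnS.
have := sum_insert h (f := fun k => bump j (word s k)) im word_lift.
by rewrite !mulnb andbA.
Qed.

End WordLift.

Lemma bump_word m (s : 'S_m.+1) k : bump m.+1 (word s k) = word s k.
Proof. by rewrite /bump leqNgt ltnS word_le. Qed.

(** The largest letter ends an ascent unless it comes first, and never starts one. *)
Lemma asc_lift_max m (s : 'S_m.+1) (i : 'I_m.+2) :
  (asc (lift_perm i ord_max s) + [&& 0 < i, i <= m & word s i.-1 < word s i]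
   = asc s + (0 < i))%N.
Proof.
rewrite !ascE; have := sum_word_lift s i ord_max (fun a b => a < b)%N.
rewrite /= !bump_word.
rewrite ltnS word_le andbT.
rewrite [(m.+1 < _)%N]ltnNge (leqW (word_le _ _)) andbF addn0 => ->.
by congr (_ + _)%N; apply: eq_bigr => k _; rewrite !bump_word.
Qed.

(** The new letter [m.+1] creates a succession only right after [m]. *)
Lemma nsucc_lift_max m (s : 'S_m.+1) (i : 'I_m.+2) :
  (nsucc (lift_perm i ord_max s)
     + [&& 0 < i, i <= m & word s i == (word s i.-1).+1]
   = nsucc s + ((0 < i) && (word s i.-1 == m)))%N.
Proof.
have := sum_word_lift s i ord_max (fun a b => b == a.+1).
rewrite /= !bump_word => ->.
have -> : (word s i == m.+2) = false.
  by apply/negbTE; rewrite neq_ltn !ltnS (leqW (word_le _ _)).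
rewrite andbF addn0 eqSS [m == _]eq_sym; congr (_ + _)%N.
by apply: eq_bigr => k _; rewrite !bump_word.
Qed.

(** * Creating a succession: the letter [(s k).+1] inserted just after [s k] *)

Section LiftSucc.
Variables (m : nat) (s : 'S_m.+1) (k : 'I_m.+1) (j : 'I_m.+2).
Hypothesis jk : val j = (s k).+1.

Let t := lift_perm (lift ord0 k) j s.

Lemma asc_lift_succ : asc t = (asc s).+1.
Proof.
have wk : word s k = s k by rewrite /word inord_val.
rewrite !ascE; have := sum_word_lift s (lift ord0 k) j (fun a b => a < b)%N.
rewrite !lift0 /= wk jk.
have -> : (bump (s k).+1 (s k) < (s k).+1)%N by rewrite /bump; lia.
have -> : ((s k).+1 < bump (s k).+1 (word s k.+1))%N = (s k < word s k.+1)%N.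
  by rewrite /bump; lia.
rewrite ltn_bump2 => /eqP; rewrite eqn_add2r addn1 => /eqP ->; congr _.+1.
by apply: eq_bigr => l _; rewrite ltn_bump2.
Qed.

(* Lifting destroys a succession at [k] in [s], but recreates it just after the
   inserted letter. *)
Lemma nsucc_lift_succ : nsucc t = (nsucc s).+1.
Proof.
have wk : word s k = s k by rewrite /word inord_val.
pose c := word s k.+1 == (s k).+1.
(* The relabelling opens a gap just above [s k], so among the old pairs only a succession at [k] is
   lost. *)
have sumE : (\sum_(0 <= l < m)
    (bump j (word s l.+1) == (bump j (word s l)).+1) + ((k < m) && c) = nsucc s)%N.
  have -> : nat_of_bool ((k < m)%N && c) = (\sum_(0 <= l < m) ((l == k) && c))%N.
    rewrite big_mkord; case: ltnP => [km|mk] /=.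
      rewrite (bigD1 (Ordinal km)) //= eqxx big1 ?addn0 // => l.
      by rewrite -val_eqE /= => /negbTE ->.
    rewrite big1 // => l _; rewrite ltn_eqF //.
    by apply: leq_trans mk.
  rewrite -big_split; apply: eq_big_nat => l /andP[_ lm] /=.
  rewrite jk; case: (eqVneq l k) => [->|lk] /=.
    rewrite wk -/c /bump /c; move: (nat_of_ord (s k)) (word s k.+1); lia.
  have : word s l != s k.
    rewrite /word val_eqE (inj_eq perm_inj) -val_eqE /= inordK //.
    by rewrite ltnS ltnW.
  rewrite /bump addn0; move: (nat_of_ord (s k)) (word s l) (word s l.+1); lia.
have := sum_word_lift s (lift ord0 k) j (fun a b => b == a.+1).
rewrite !lift0 /= -/(nsucc t) wk -sumE jk /c.
move: (\sum_(0 <= l < m) _)%N (nsucc t) => a b.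
move: (k < m)%N (nat_of_ord (s k)) (word s k.+1) => e x y.
by rewrite /bump; case: e => /=; lia.
Qed.

End LiftSucc.

(** Contracting the succession at [k] is a bijection: given the rest [t], the letter at [k.+1] must
    be one more than [t k]. *)
Lemma sum_succ_at (V : nmodType) m (k : 'I_m.+1) (F : 'S_m.+2 -> V) :
  \sum_(s : 'S_m.+2 | word s k.+1 == (word s k).+1) F s =
  \sum_(t : 'S_m.+1) F (lift_perm (lift ord0 k) (lift ord0 (t k)) t).
Proof.
rewrite (partition_big (fun s : 'S_m.+2 => s (lift ord0 k)) xpredT) //=.
under eq_bigr => j _.
  rewrite big_mkcondl sum_lift_perm.
  over.
rewrite exchange_big; apply: eq_bigr => t _ /=.
rewrite -big_mkcond (big_pred1 (lift ord0 (t k))) // => j /=.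
rewrite !word_lift; [|have := ltn_ord k; lia..].
rewrite !lift0 ltnn eqxx ltnSn -val_eqE [val (lift _ _)]lift0 /word inord_val.
by rewrite /bump /=; move: (nat_of_ord (t k)) (nat_of_ord j) => a b; lia.
Qed.

(** * Ascent polynomials: recurrence and comparison with derangements *)

Definition succpoly m : {poly rat} :=
  \sum_(s : 'S_m.+1 | no_succ s) 'X ^+ asc s.

(** Without successions, every slot is allowed except the one after the letter [m]. With exactly
    one, only the slot inside it is, and the ascent split there is regained. With more, none is. *)
Lemma sum_insert_max m (s : 'S_m.+1) :
  \sum_(i : 'I_m.+2 | no_succ (lift_perm i ord_max s))
     'X ^+ asc (lift_perm i ord_max s) =
  (if no_succ s then 'X ^+ asc s + 'X * 'X ^+ asc s *+ m
      + 'X * (1 - 'X) * ('X ^+ asc s)^`() else 0) +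
  \sum_(k < m | word s k.+1 == (word s k).+1)
     (if nsucc s == 1%N then 'X ^+ asc s else 0) :> {poly rat}.
Proof.
pose L (k : 'I_m.+1) := lift_perm (lift ord0 k) ord_max s.
have LA k : (asc (L k) + ((k < m) && (word s k < word s k.+1)) = (asc s).+1)%N.
  by have := asc_lift_max s (lift ord0 k); rewrite lift0 /= addn1.
have LS k : (nsucc (L k) + ((k < m) && (word s k.+1 == (word s k).+1))
    = nsucc s + (word s k == m))%N.
  by have := nsucc_lift_max s (lift ord0 k); rewrite lift0.
rewrite big_mkcond big_ord_recl -big_mkcond /=.
have := asc_lift_max s ord0; rewrite /= !addn0 => ->.
have := nsucc_lift_max s ord0; rewrite /= !addn0 no_succE => ->.
rewrite no_succE; case: eqVneq => [s0|s0] /=; last first.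
  rewrite !add0r -/(L _) [RHS]big_mkcond /= big_mkcond big_ord_recr /=.
  rewrite ifN ?addr0.
    apply: eq_bigr => k _; have := LS (widen_ord (leqnSn m) k).
    have := LA (widen_ord (leqnSn m) k); rewrite -/(L _) /= ltn_ord /= no_succE.
    (* A letter starting a succession is below [m], so no new succession arises in breaking it. *)
    have := word_le s k.+1.
    case: eqVneq => [->|] /=.
      move=> wm; rewrite ltnSn (ltn_eqF wm) addn0 !addn1 => -[->] <-.
      by rewrite eqSS.
    by move=> _ _ _; rewrite addn0 => ->; rewrite ifN // addn_eq0 negb_and s0.
  have := LS ord_max; rewrite ltnn addn0 no_succE => ->.
  by rewrite addn_eq0 negb_and s0.
rewrite [X in _ = _ + X]big1 ?addr0; last by rewrite s0.
rewrite -!addrA; congr (_ + _).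
pose b (k : 'I_m.+1) := (k < m)%N && (word s k < word s k.+1)%N.
have bs : (\sum_(k < m.+1) b k = asc s)%N.
  rewrite ascE big_ord_recr /b /= ltnn addn0 big_mkord.
  by apply: eq_bigr => k _; rewrite ltn_ord.
have := sum_exponent_shift bs LA.
rewrite (bigID (fun k : 'I_m.+1 => word s k == m)) /=.
rewrite (big_pred1 (s^-1%g ord_max)); last first.
  move=> k /=; rewrite -(inj_eq (@perm_inj _ s)) permKV -val_eqE /=.
  by rewrite /word inord_val.
set k0 := (s^-1)%g ord_max.
have -> : asc (L k0) = (asc s).+1.
  have wk0 : word s k0 = m by rewrite /word inord_val permKV.
  by have := LA k0; rewrite wk0 [(m < _)%N]ltnNge word_le andbF addn0.
(* Removing the forbidden slot, of exponent [(asc s).+1], lowers the multiplicity from [m.+1] to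
   [m]. *)
rewrite mulrS -exprS -!addrA => /addrI <-.
apply: eq_bigl => k; rewrite no_succE.
have := LS k; rewrite s0 add0n; have := word_le s k.+1.
case: (eqVneq (word s k) m) => [->|_] /=; last first.
  by move=> _ /eqP; rewrite addn_eq0 => /andP[].
by rewrite -ltnS => /ltn_eqF ->; rewrite andbF addn0 => ->.
Qed.

Lemma succpoly_rec m : succpoly m.+2 =
  succpoly m.+1 + 'X * (succpoly m.+1 + succpoly m) *+ m.+1
    + 'X * (1 - 'X) * (succpoly m.+1)^`().
Proof.
rewrite {1}/succpoly big_mkcond sum_perm_lift_max.
under eq_bigr => s _ do rewrite -big_mkcond sum_insert_max.
rewrite big_split /= -big_mkcond /=.
(* Contracting the only succession leaves a word without any and with one ascent less. *)
have -> : \sum_(s : 'S_m.+2)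
    \sum_(k < m.+1 | word s k.+1 == (word s k).+1)
       (if nsucc s == 1%N then 'X ^+ asc s else 0)
  = 'X * succpoly m *+ m.+1 :> {poly rat}.
  rewrite (exchange_big_dep xpredT) //=.
  rewrite -[X in _ *+ X]card_ord -sumr_const; apply: eq_bigr => k _.
  rewrite sum_succ_at mulr_sumr [RHS]big_mkcond; apply: eq_bigr => t _.
  have tk : val (lift ord0 (t k)) = (t k).+1 := lift0 (t k).
  by rewrite asc_lift_succ // nsucc_lift_succ // eqSS no_succE -exprS.
rewrite !big_split /= sumrMnl -!mulr_sumr -raddf_sum /= -/(succpoly _).
by ring.
Qed.

Lemma asc_S1 (s : 'S_1) : asc s = 0%N.
Proof. by rewrite ascE big_nil. Qed.

Lemma no_succ_S1 (s : 'S_1) : no_succ s.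
Proof. by rewrite no_succE /nsucc big_nil. Qed.

Lemma succpoly0 : succpoly 0 = 1.
Proof.
rewrite /succpoly (eq_bigr (fun=> 1)) => [|s _]; last by rewrite asc_S1.
rewrite (eq_bigl xpredT) => [|s]; last exact: no_succ_S1.
by rewrite sumr_const card_Sn.
Qed.

Lemma succpoly1 : succpoly 1 = 1.
Proof.
rewrite /succpoly big_mkcond sum_perm_lift_max -[RHS]succpoly0 /succpoly.
rewrite [RHS]big_mkcond /=; apply: eq_bigr => s _.
rewrite -big_mkcond sum_insert_max big_ord0 no_succ_S1 asc_S1.
by rewrite mulr0n derivC mulr0 !addr0.
Qed.

Lemma succpoly_derpoly n : 'X * succpoly n = derpoly n.+1 + 'X * derpoly n.
Proof.
suff: 'X * succpoly n = derpoly n.+1 + 'X * derpoly n /\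
  'X * succpoly n.+1 = derpoly n.+2 + 'X * derpoly n.+1 by case.
elim: n => [|n [IH0 IH1]].
  rewrite derpoly_rec succpoly0 succpoly1 derpoly0 derpoly1 derivC.
  by split; ring.
split=> //.
(* With q = [succpoly n.+1], x^2 q' = x (x q)' - x q, and x q is known by induction. *)
have dQ : 'X * ('X * (succpoly n.+1)^`()) =
    'X * (derpoly n.+2 + 'X * derpoly n.+1)^`() - (derpoly n.+2 + 'X * derpoly n.+1).
  by rewrite -IH1 derivM derivX; ring.
have -> : 'X * succpoly n.+2 = ('X * succpoly n.+1)
    + 'X * ('X * succpoly n.+1 + 'X * succpoly n) *+ n.+1
    + (1 - 'X) * ('X * ('X * (succpoly n.+1)^`())).
  by rewrite succpoly_rec; ring.
rewrite dQ IH0 IH1 derivD derivM derivX.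
have d2 := derpoly_rec n; have d3 := derpoly_rec n.+1.
have E2 : 'X * (1 - 'X) * (derpoly n.+1)^`() =
   derpoly n.+2 - 'X * (derpoly n.+1 + derpoly n) *+ n.+1 by rewrite d2; ring.
rewrite d3.
(* The last summand vanishes by [E2]; it absorbs the derivative of [derpoly n.+1]. *)
transitivity ('X * (derpoly n.+2 + derpoly n.+1) *+ n.+2 +
    'X * (1 - 'X) * (derpoly n.+2)^`() + 'X * derpoly n.+2
   + 'X * ('X * (1 - 'X) * (derpoly n.+1)^`()
     - (derpoly n.+2 - 'X * (derpoly n.+1 + derpoly n) *+ n.+1))); last first.
  by rewrite E2 subrr mulr0 addr0.
by ring.
Qed.

Theorem theorem15 :
  (exists a : nat -> {poly rat}, is_dB a) /\
  (forall a : nat -> {poly rat}, is_dB a ->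
     forall n : nat, (0 < n)%N ->
       'X * a n = derpoly n.+1 + 'X * derpoly n /\
       a n = \sum_(s : 'S_n.+1 | no_succ s) 'X ^+ asc s).
Proof.
(* With this witness, no quotient by x has to be formed. *)
have dB : is_dB succpoly.
  exact: (is_dB_of_derangement derpoly0 derpoly1 derpoly_rec succpoly_derpoly).
split; first by exists succpoly.
by move=> a /is_dB_unique/(_ dB) E n _; rewrite !E succpoly_derpoly.
Qed.
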